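(* Let $(\mathfrak{a},\bullet)$ be an associative affgebra over a field $\mathbb{F}$ and let $D\colon\mathfrak{a}\to\mathfrak{a}$ be an affine map. Then $D$ is a deriffation on $\mathfrak{a}$ if and only if, for every $o\in\mathfrak{a}$, the linearization $T_oD\colon T_o\mathfrak{a}\to T_o\mathfrak{a}$, $T_oD(a)=D(a)-D(o)$, is a derivation on the associative algebra $(T_o\mathfrak{a},\cdot_o)$.
   Context: **Affine spaces.** An abelian heap is a set with a ternary operation $\langle -,-,-\rangle$ satisfying $\langle\langle a,b,c\rangle,d,e\rangle=\langle a,b,\langle c,d,e\rangle\rangle$, $\langle a,b,b\rangle=a=\langle b,b,a\rangle$ and $\langle a,b,c\rangle=\langle c,b,a\rangle$. An ($\mathbb{F}$-)affine space is a non-empty abelian heap $\mathfrak{a}$ with a map $\mathbb{F}\times\mathfrak{a}\times\mathfrak{a}\to\mathfrak{a}$, $(\alpha,a,b)\mapsto\alpha\triangleright_a b$, such that $\alpha\triangleright_a-$ is a heap morphism, $-\triangleright_a b$ is a heap morphism (with $\langle\alpha,\beta,\gamma\rangle=\alpha-\beta+\gamma$ on $\mathbb{F}$), $1\triangleright_a b=b$, $\alpha\triangleright_a(\beta\triangleright_a b)=(\alpha\beta)\triangleright_a b$, $0\triangleright_a b=a$, and $\alpha\triangleright_a b=\langle\alpha\triangleright_c b,\alpha\triangleright_c a,a\rangle$. An affine map is a heap morphism $f$ with $f(\alpha\triangleright_a b)=\alpha\triangleright_{f(a)}f(b)$; a bi-affine map is affine in each argument. For $o\in\mathfrak{a}$,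 the tangent space (fibre) $T_o\mathfrak{a}$ is the set $\mathfrak{a}$ with the vector space structure $a+b=\langle a,o,b\rangle$, $\alpha a=\alpha\triangleright_o a$, zero element $o$; then $\langle a,b,c\rangle=a-b+c$. **Associative affgebra.** An affine space $\mathfrak{a}$ with an associative bi-affine product $\bullet$. For $o\in\mathfrak{a}$, $T_o\mathfrak{a}$ is an associative algebra with product $a\cdot_o b=a\bullet b-a\bullet o+o\bullet o-o\bullet b$ (operations in $T_o\mathfrak{a}$). **Deriffation.** For an affine map $D\colon\mathfrak{a}\to\mathfrak{a}$, its derivator is the bi-affine map $\Delta^D(a,b)=\langle D(a)\bullet b,D(a\bullet b),a\bullet D(b)\rangle$. For $o\in\mathfrak{a}$ put $T_o\Delta^D(a,b)=\Delta^D(a,b)-\Delta^D(a,o)+\Delta^D(o,o)-\Delta^D(o,b)$ in $T_o\mathfrak{a}$. $D$ is a deriffation (affine derivation) if for all $o\in\mathfrak{a}$, $T_o\Delta^D(a,b)=o$ for all $a,b\in\mathfrak{a}$. *)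

(* Defs.v *)
From HB Require Import structures.
From mathcomp Require Import all_boot all_algebra.

Set Implicit Arguments.
Unset Strict Implicit.
Unset Printing Implicit Defensive.

Import GRing.Theory.
Local Open Scope ring_scope.

HB.mixin Record isAbelianHeap H := {
  heap : H -> H -> H -> H;
  heapA : forall a b c d e, heap (heap a b c) d e = heap a b (heap c d e);
  heapKr : forall a b, heap a b b = a;
  heapKl : forall a b, heap b b a = a;
  heapC : forall a b c, heap a b c = heap c b a
}.

#[short(type="abelianHeapType")]
HB.structure Definition AbelianHeap := {H of isAbelianHeap H & Choice H}.

Definition heap_morphism (H K : abelianHeapType) (f : H -> K) : Prop :=
  forall a b c, f (heap a b c) = heap (f a) (f b) (f c).

(* An alias of a Z-module V, carrying the heap <a, b, c> = a - b + c. *)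
Definition zmod_heap (V : zmodType) : Type := V.

Section ZmodHeap.
Variable V : zmodType.
Implicit Types a b c d e : V.

Let op a b c := a - b + c.

Fact zmod_heapA a b c d e : op (op a b c) d e = op a b (op c d e).
Proof. by rewrite /op !addrA. Qed.

Fact zmod_heapKr a b : op a b b = a.
Proof. by rewrite /op subrK. Qed.

Fact zmod_heapKl a b : op b b a = a.
Proof. by rewrite /op subrr add0r. Qed.

Fact zmod_heapC a b c : op a b c = op c b a.
Proof. by rewrite /op addrC [a - b]addrC addrA. Qed.

HB.instance Definition _ := Choice.on (zmod_heap V).
HB.instance Definition _ := isAbelianHeap.Build (zmod_heap V)
  zmod_heapA zmod_heapKr zmod_heapKl zmod_heapC.

End ZmodHeap.

(* act alpha a b is the action of the scalar alpha on b with base point a. *)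
HB.mixin Record isAffineSpace (F : fieldType) A of AbelianHeap A := {
  affine_inhabited : inhabited A;
  act : F -> A -> A -> A;
  act_heapr : forall (alpha : F) (a : A),
    heap_morphism (fun b : A => act alpha a b);
  act_heapl : forall a b : A,
    heap_morphism (fun alpha : zmod_heap F => act alpha a b);
  act1 : forall a b : A, act 1 a b = b;
  actA : forall (alpha beta : F) (a b : A),
    act alpha a (act beta a b) = act (alpha * beta) a b;
  act0 : forall a b : A, act 0 a b = a;
  act_base : forall (alpha : F) (a b c : A),
    act alpha a b = heap (act alpha c b) (act alpha c a) a
}.

#[short(type="affineSpaceType")]
HB.structure Definition AffineSpace (F : fieldType) :=
  {A of isAffineSpace F A & AbelianHeap A}.

Section AffineMaps.
Variables (F : fieldType) (A B : affineSpaceType F).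

Definition affine_map (f : A -> B) : Prop :=
  heap_morphism f /\
  forall (alpha : F) (a b : A), f (act alpha a b) = act alpha (f a) (f b).

End AffineMaps.

Definition biaffine_map (F : fieldType) (A B C : affineSpaceType F)
    (m : A -> B -> C) : Prop :=
  (forall b, affine_map (fun a => m a b)) /\ (forall a, affine_map (m a)).

HB.mixin Record isAffgebra (F : fieldType) A of AffineSpace F A := {
  affmul : A -> A -> A;
  affmul_biaffine : biaffine_map affmul;
  affmulA : associative affmul
}.

#[short(type="affgebraType")]
HB.structure Definition Affgebra (F : fieldType) :=
  {A of isAffgebra F A & AffineSpace F A}.

(* Associative algebras without a unit; MathComp's algType is unital. *)
HB.mixin Record isAssocAlgebra (F : fieldType) V of GRing.Lmodule F V := {
  amul : V -> V -> V;
  amul_linearl : forall y : V, linear (fun x : V => amul x y);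
  amul_linearr : forall x : V, linear (amul x);
  amulA : associative amul
}.

#[short(type="assocAlgType")]
HB.structure Definition AssocAlgebra (F : fieldType) :=
  {V of isAssocAlgebra F V & GRing.Lmodule F V}.

Definition derivation (F : fieldType) (V : assocAlgType F) (d : V -> V)
    : Prop :=
  linear d /\ forall x y, d (amul x y) = amul (d x) y + amul x (d y).

(* The tangent space (fibre) of A at o: an alias of A, which the instances    *)
(* below equip with the vector space structure with zero element o.           *)
Definition tangent (F : fieldType) (A : affineSpaceType F) (o : A) : Type := A.

Section Tangent.
Variables (F : fieldType) (A : affineSpaceType F) (o : A).
Implicit Types (a b c : A) (alpha beta : F).

Let add a b := heap a o b.
Let opp a := heap o a o.
Let scale alpha a := act alpha o a.

Fact tangent_addA : associative add.
Proof. by move=> a b c; rewrite /add heapA. Qed.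

Fact tangent_addC : commutative add.
Proof. by move=> a b; rewrite /add heapC. Qed.

Fact tangent_add0 : left_id o add.
Proof. by move=> a; rewrite /add heapKl. Qed.

Fact tangent_addN : left_inverse o opp add.
Proof. by move=> a; rewrite /add /opp heapA heapKl heapKr. Qed.

HB.instance Definition _ := Choice.on (tangent o).
HB.instance Definition _ := GRing.isZmodule.Build (tangent o)
  tangent_addA tangent_addC tangent_add0 tangent_addN.

Lemma act_fix alpha : act alpha o o = o.
Proof. by rewrite -[X in act _ _ X](act0 o o) actA mulr0 act0. Qed.

Lemma tangent_heapE a b c :
  heap a b c = (a : tangent o) - (b : tangent o) + (c : tangent o).
Proof.
by rewrite /GRing.add /GRing.opp /= /add /opp !heapA heapKl -heapA heapKr.
Qed.

Fact tangent_scaleA alpha beta a :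
  scale alpha (scale beta a) = scale (alpha * beta) a.
Proof. exact: actA. Qed.

Fact tangent_scale1 : left_id 1 scale.
Proof. exact: act1. Qed.

Fact tangent_scaleDr : right_distributive scale (+%R : tangent o -> _).
Proof. by move=> alpha a b; rewrite /scale act_heapr act_fix. Qed.

Fact tangent_scaleDl (a : tangent o) :
  {morph (fun alpha => scale alpha a : tangent o) : alpha beta / alpha + beta}.
Proof.
move=> alpha beta; have := act_heapl o a alpha 0 beta.
by rewrite act0 {1}/heap /= subr0.
Qed.

HB.instance Definition _ := GRing.Zmodule_isLmodule.Build F (tangent o)
  tangent_scaleA tangent_scale1 tangent_scaleDr tangent_scaleDl.

End Tangent.

(* T_o D (a) = D(a) - D(o), computed in the tangent space at o. *)
Definition linearization (F : fieldType) (A : affineSpaceType F) (o : A)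
    (D : A -> A) (a : tangent o) : tangent o :=
  (D a : tangent o) - (D o : tangent o).

(* m(a, b) - m(a, o) + m(o, o) - m(o, b), computed in the tangent space at o. *)
Definition bilinearization (F : fieldType) (A : affineSpaceType F) (o : A)
    (m : A -> A -> A) (a b : tangent o) : tangent o :=
  (m a b : tangent o) - (m a o : tangent o) + (m o o : tangent o)
  - (m o b : tangent o).

Arguments linearization {F A} o D a.
Arguments bilinearization {F A} o m a b.

Section Linearization.
Variables (F : fieldType) (A : affineSpaceType F) (o : A).

Lemma affine_linearization (D : A -> A) :
  affine_map D -> linear (linearization o D).
Proof.
move=> [Dheap Dact] alpha a b; rewrite /linearization.
have -> : alpha *: a + b = heap (act alpha o a) o b by [].
rewrite Dheap Dact (act_base alpha (D o) (D a) o) !(tangent_heapE o).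
have scaleE x : act alpha o x = alpha *: (x : tangent o) by [].
by rewrite !scaleE scalerBr addrK addrA.
Qed.

Lemma biaffine_bilinearization (m : A -> A -> A) : biaffine_map m ->
  (forall b, linear (fun a => bilinearization o m a b)) /\
  (forall a, linear (bilinearization o m a)).
Proof.
move=> [ml mr]; split=> [b | a] alpha x y.
  have lin u := affine_linearization (ml u) alpha x y.
  have E z : bilinearization o m z b =
      linearization o (m^~ b) z - linearization o (m^~ o) z.
    by rewrite /linearization /bilinearization opprB addrA
               [RHS](ACl (1*4*3*2)).
  by rewrite !E !lin [in RHS]scalerBr opprD addrACA.
have lin u := affine_linearization (mr u) alpha x y.
have E z : bilinearization o m a z =
    linearization o (m a) z - linearization o (m o) z.
  by rewrite /linearization /bilinearization opprB addrA.
by rewrite !E !lin [in RHS]scalerBr opprD addrACA.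
Qed.

End Linearization.

(* The product a ._o b of the algebra T_o A. *)
Definition tangent_mul (F : fieldType) (A : affgebraType F) (o : A) :
    tangent o -> tangent o -> tangent o :=
  bilinearization o affmul.

Section TangentAlgebra.
Variables (F : fieldType) (A : affgebraType F) (o : A).

Fact tangent_mulA : associative (@tangent_mul F A o).
Proof.
have [linl linr] := biaffine_bilinearization o (@affmul_biaffine F A).
have lin4 (f : tangent o -> tangent o) : linear f ->
    forall x y z t, f (x - y + z - t) = f x - f y + f z - f t.
  move=> lf x y z t; have fB u v : f (u - v) = f u - f v.
    by rewrite addrC -scaleN1r lf scaleN1r addrC.
  have fD u v : f (u + v) = f u + f v by rewrite -[u]scale1r lf !scale1r.
  by rewrite fB fD fB.
have sum4 (x y z t k : tangent o) :
    (x + k) - (y + k) + (z + k) - (t + k) = x - y + z - t.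
  by rewrite !opprD [LHS](AC (2*2*2*2) ((1*3*5*7)*(2*4*6*8))) /= subrr add0r
             subrr addr0.
move=> a b c; pose p x y : tangent o := affmul x y.
have mulE x y : bilinearization o affmul x y =
    p x y - p x o + p o o - p o y by [].
have mulEr x y : bilinearization o affmul x y =
    (p x y - p o y) + (p o o - p x o).
  by rewrite mulE [LHS](ACl ((1*4)*(3*2))).
have mulEl x y : bilinearization o affmul x y =
    (p x y - p x o) + (p o o - p o y).
  by rewrite mulE addrA.
rewrite /tangent_mul [bilinearization o affmul b c]mulE.
rewrite [bilinearization o affmul a b]mulE (lin4 _ (linr a)) (lin4 _ (linl c)).
rewrite ![bilinearization _ _ a _]mulEr sum4.
rewrite ![bilinearization _ _ _ c]mulEl sum4.
by rewrite /p !affmulA !opprB !addrA [LHS](ACl (1*4*5*8*7*6*3*2)).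
Qed.

HB.instance Definition _ := isAssocAlgebra.Build F (tangent o)
  (biaffine_bilinearization o affmul_biaffine).1
  (biaffine_bilinearization o affmul_biaffine).2
  tangent_mulA.

End TangentAlgebra.

Definition derivator (F : fieldType) (A : affgebraType F) (D : A -> A)
    (a b : A) : A :=
  heap (affmul (D a) b) (D (affmul a b)) (affmul a (D b)).

Definition deriffation (F : fieldType) (A : affgebraType F) (D : A -> A)
    : Prop :=
  affine_map D /\
  forall o a b : A, bilinearization o (derivator D) a b = o.

(* Main.v *)
(* In T_o A an affine map is a linear map plus a constant, and a bi-affine map
   is its bilinearization plus linear and constant terms. Hence the bilinear
   part of the derivator of D at o is d(a) b - d(a b) + a d(b), where d = T_o D
   and the product is that of the algebra T_o A: it vanishes exactly when d is
   a derivation. The equivalence therefore holds separately at each o. *)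
Require Import Defs.
From mathcomp Require Import all_boot all_algebra.

Import GRing.Theory.
Local Open Scope ring_scope.

Lemma linear_sub (F : fieldType) (U V : lmodType F) (f : U -> V) :
  linear f -> {morph f : x y / x - y}.
Proof. by move=> lf x y; rewrite addrC -scaleN1r lf scaleN1r addrC. Qed.

Arguments linear_sub {F U V f}.

Section Bilinearization.
Variables (F : fieldType) (A : affineSpaceType F) (o : A).

(** In [tangent o] the heap operation is [x - y + z], and [bilinearization] is a signed sum of
    values, so the two sums can be interchanged. *)
Lemma bilinearization_heap (m n p : A -> A -> A) (a b : tangent o) :
  bilinearization o (fun x y => heap (m x y) (n x y) (p x y)) a b =
  bilinearization o m a b - bilinearization o n a b + bilinearization o p a b.
Proof.
rewrite /bilinearization !(tangent_heapE o) !opprD !opprK !addrA.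
by rewrite [LHS](ACl (1*4*7*10*2*5*8*11*3*6*9*12)).
Qed.

Lemma bilinearization_comp (D : A -> A) (m : A -> A -> A) (a b : tangent o) :
  affine_map D ->
  bilinearization o (fun x y => D (m x y)) a b =
  linearization o D (bilinearization o m a b).
Proof.
move=> /(affine_linearization (o := o)) ld.
(* The constant [D o] cancels in a difference, leaving the linear part; the four signed terms of the
   bilinearization pair into two differences. *)
have DB (x y : tangent o) :
    (D x : tangent o) - (D y : tangent o) = linearization o D (x - y).
  by rewrite (linear_sub ld) /linearization opprB addrA subrK.
rewrite /bilinearization -!(addrA (_ - _)) !DB.
by rewrite -[(m a b : tangent o) - _]scale1r ld !scale1r.
Qed.

(** Linearity in the first argument splits the right side at [D a] and [D o]; the terms [m o o] and
    [m o b], independent of that argument, cancel. *)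
Lemma bilinearization_compl (D : A -> A) (m : A -> A -> A) (a b : tangent o) :
  biaffine_map m ->
  bilinearization o (fun x y => m (D x) y) a b =
  bilinearization o m (linearization o D a) b.
Proof.
move=> /(biaffine_bilinearization o)[/(_ b)/linear_sub -> _].
rewrite /bilinearization !opprD !opprK !addrA.
by rewrite [RHS](ACl (1*2*6*5*(3*7)*(4*8))) /= subrr addNr !addr0.
Qed.

Lemma bilinearization_compr (D : A -> A) (m : A -> A -> A) (a b : tangent o) :
  biaffine_map m ->
  bilinearization o (fun x y => m x (D y)) a b =
  bilinearization o m a (linearization o D b).
Proof.
move=> /(biaffine_bilinearization o)[_ /(_ a)/linear_sub ->].
rewrite /bilinearization !opprD !opprK !addrA.
by rewrite [RHS](ACl (1*5*8*4*(2*6)*(3*7))) /= addNr subrr !addr0.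
Qed.

End Bilinearization.

Lemma bilinearization_derivator (F : fieldType) (A : affgebraType F) (o : A)
    (D : A -> A) (a b : tangent o) :
  affine_map D ->
  bilinearization o (derivator D) a b =
  amul (linearization o D a) b - linearization o D (amul a b)
  + amul a (linearization o D b).
Proof.
(* On [tangent o], [amul] is by definition the bilinearization of [affmul]. *)
move=> hD; rewrite bilinearization_heap bilinearization_comp //.
have pA := @affmul_biaffine F A.
rewrite (bilinearization_compl F A o D affmul a b pA).
by rewrite (bilinearization_compr F A o D affmul a b pA).
Qed.

Theorem proposition3p4 (F : fieldType) (A : affgebraType F) (D : A -> A)
    (hD : affine_map D) :
  deriffation D <-> forall o : A, derivation (linearization o D).
Proof.
have derE (o : A) (a b : tangent o) :
    bilinearization o (derivator D) a b = o <->
    linearization o D (amul a b) =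
    amul (linearization o D a) b + amul a (linearization o D b).
  rewrite bilinearization_derivator // addrAC.
  (* The point [o] is convertible to the zero of [tangent o], so the equation reads as a vanishing
     difference. *)
  split=> [/(@subr0_eq (tangent o)) -> // | ->].
  exact: (@subrr (tangent o)).
split=> [[_ der] o | der].
  by split=> [|x y]; [apply: affine_linearization | apply/derE].
by split=> // o a b; apply/derE; case: (der o) => _; apply.
Qed.
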